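(* Let $n\ge 1$ and let $\mathcal{A}_n$ be the set of $n\times n$ alternating sign matrices. Let $G_n$ be the $n\times n$ grid graph and let $\mathrm{ResLuc}(G_n)$ be the set of restricted Lucas-colorings of $G_n$ (both defined in the context). Then there is a bijection between $\mathcal{A}_n$ and $\mathrm{ResLuc}(G_n)$.
   Context: An alternating sign matrix (ASM) is a square matrix with entries in $\{-1,0,+1\}$ such that every row and every column sums to $1$ and, in each row and each column, the non-zero entries alternate in sign. The grid graph $G_n$: take $n$ horizontal line segments $H_1,\dots,H_n$ (from top to bottom) and $n$ vertical line segments $V_1,\dots,V_n$ (from left to right) in the plane such that each $H_i$ meets each $V_j$ transversally in exactly one point. The vertices of $G_n$ are the $n^2$ intersection points $H_i\cap V_j$ (the internal vertices, each of degree $4$) together with the $4n$ endpoints of the segments (each of degree $1$); the edges are the sub-segments between consecutive vertices along each $H_i$ and each $V_j$. A boundary edge is an edge incident to an endpoint. The boundary edges form four sides: the $n$ edges at the left ends of the $H_i$, the $n$ edges at the top ends of the $V_j$, the $n$ edges at the right ends of the $H_i$, and the $n$ edges at the bottom ends of the $V_j$, each side ordered along the boundary. At each of the four corners of the grid, two boundary edges are nearest to that corner, one from each of the two sides meeting there (e.g. at the top-left corner: the left edge of $H_1$ and the top edge of $V_1$). A restricted Lucas-coloring of $G_n$ is a coloring of the edges of $G_n$ by the two colors red and green such that: (1) at each internal vertex, the four incident edges are either all green, or all red, or exactly two of them are red and these two are consecutive in the cyclic order around the vertex (i.e. one lies on the horizontal line and one on the vertical line through the vertex) — these are the six allowed local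 colorings; (2) on each of the four sides, the $n$ boundary edges alternate in color along the side; (3) at each of the four corners, the two boundary edges nearest to that corner have the same color; (4) (normalization) the boundary edge at the left end of $H_1$ is green. *)

(* Defs.v *)
From HB Require Import structures.
From mathcomp Require Import all_boot all_order all_algebra.

Set Implicit Arguments.
Unset Strict Implicit.
Unset Printing Implicit Defensive.

Import GRing.Theory Num.Theory.
Local Open Scope ring_scope.

Definition sign_alternating (s : seq int) : bool :=
  sorted (fun x y => x * y < 0) [seq x <- s | x != 0].

Definition is_asm (n : nat) (A : 'M[int]_n) : bool :=
  [&& [forall i, forall j, A i j \in [:: -1; 0; 1]],
      [forall i, \sum_j A i j == 1],
      [forall j, \sum_i A i j == 1],
      [forall i, sign_alternating [seq A i j | j <- enum 'I_n]]
    & [forall j, sign_alternating [seq A i j | i <- enum 'I_n]]].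

Definition ASM (n : nat) : Type := {A : 'M[int]_n | is_asm A}.

(* Indices are 0-based: the ordinal i stands for H_(i+1) or V_(i+1).
   Endpoint Left i and Endpoint Right i are the ends of a horizontal line,
   Endpoint Top j and Endpoint Bottom j those of a vertical line. *)
Variant side := Left | Top | Right | Bottom.

Variant gvertex (n : nat) :=
  | Internal of 'I_n & 'I_n
  | Endpoint of side & 'I_n.
Arguments Internal {n}.
Arguments Endpoint {n}.

(* The n + 2 vertices on a line, numbered 0, ..., n + 1 from left to right
   (resp. from top to bottom). *)
Definition hvertex (n : nat) (i : 'I_n) (k : nat) : gvertex n :=
  if k is k'.+1 then
    if insub k' is Some j then Internal i j else Endpoint Right i
  else Endpoint Left i.

Definition vvertex (n : nat) (j : 'I_n) (k : nat) : gvertex n :=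
  if k is k'.+1 then
    if insub k' is Some i then Internal i j else Endpoint Bottom j
  else Endpoint Top j.

(* inl (i, k) is the k-th of the n + 1 edges of a horizontal line, counted from
   the left; inr (j, k) the k-th edge of a vertical line, counted from the
   top. *)
Definition gedge (n : nat) : finType :=
  ('I_n * 'I_n.+1 + 'I_n * 'I_n.+1)%type.

Definition hedge (n : nat) (i : 'I_n) (k : 'I_n.+1) : gedge n := inl (i, k).
Definition vedge (n : nat) (j : 'I_n) (k : 'I_n.+1) : gedge n := inr (j, k).

Definition gends (n : nat) (e : gedge n) : gvertex n * gvertex n :=
  match e with
  | inl (i, k) => (hvertex i k, hvertex i k.+1)
  | inr (j, k) => (vvertex j k, vvertex j k.+1)
  end.

Definition incident (n : nat) (e : gedge n) (v : gvertex n) : Prop :=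
  (gends e).1 = v \/ (gends e).2 = v.

(* The edges at an internal vertex in cyclic order: left, top, right, bottom. *)
Definition edges_around (n : nat) (i j : 'I_n) : seq (gedge n) :=
  [:: hedge i (inord j); vedge j (inord i);
      hedge i (inord j.+1); vedge j (inord i.+1)].

Definition boundary_edge (n : nat) (s : side) (k : 'I_n) : gedge n :=
  match s with
  | Left => hedge k ord0
  | Top => vedge k ord0
  | Right => hedge k ord_max
  | Bottom => vedge k ord_max
  end.

Lemma hvertex_internal n (i' : 'I_n) (k : nat) (i j : 'I_n) :
  hvertex i' k = Internal i j <-> i' = i /\ k = j.+1.
Proof.
split=> [|[-> ->]] /=; last by rewrite valK.
case: k => [|k] //=; case: insubP => // u _ <- [-> ->] //.
Qed.

Lemma vvertex_internal n (j' : 'I_n) (k : nat) (i j : 'I_n) :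
  vvertex j' k = Internal i j <-> j' = j /\ k = i.+1.
Proof.
split=> [|[-> ->]] /=; last by rewrite valK.
case: k => [|k] //=; case: insubP => // u _ <- [-> ->] //.
Qed.

Lemma incident_internal n (e : gedge n) (i j : 'I_n) :
  incident e (Internal i j) <-> e \in edges_around i j.
Proof.
have ltS (k : 'I_n) : (k < n.+1)%N by rewrite ltnS ltnW.
have ltSS (k : 'I_n) : (k.+1 < n.+1)%N by rewrite ltnS.
rewrite /edges_around !inE; case: e => [] [l k]; split.
- case=> /hvertex_internal [-> h]; apply/or4P; [apply: Or43 | apply: Or41];
    apply/eqP; congr (inl (_, _)); apply: val_inj; rewrite /= inordK //.
  by case: h.
- case/or4P=> /eqP // [-> ->]; [right | left];
    by apply/hvertex_internal; rewrite inordK.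
- case=> /vvertex_internal [-> h]; apply/or4P; [apply: Or44 | apply: Or42];
    apply/eqP; congr (inr (_, _)); apply: val_inj; rewrite /= inordK //.
  by case: h.
- case/or4P=> /eqP // [-> ->]; [right | left];
    by apply/vvertex_internal; rewrite inordK.
Qed.

Lemma incident_endpoint n (e : gedge n) (s : side) (k : 'I_n) :
  incident e (Endpoint s k) <-> e = boundary_edge s k.
Proof.
have max (m : 'I_n.+1) : ~~ (m < n)%N -> m = ord_max.
  by rewrite -leqNgt => h; apply/val_inj/eqP; rewrite /= eqn_leq h -ltnS ltn_ord.
rewrite /incident; split.
  case: e => [] [l m] /=; case=> h.
  - case: m h => [[|m] mn] /=; first by case=> <- <-; congr (inl (_, _)); apply: val_inj.
    by case: insubP => //; rewrite -ltnS mn.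
  - by move: h; case: insubP => // mn [<- <-]; rewrite (max _ mn).
  - case: m h => [[|m] mn] /=; first by case=> <- <-; congr (inr (_, _)); apply: val_inj.
    by case: insubP => //; rewrite -ltnS mn.
  - by move: h; case: insubP => // mn [<- <-]; rewrite (max _ mn).
move=> ->; case: s => /=; [by left | by left | right | right];
  by rewrite insubF // ltnn.
Qed.

Variant color := Red | Green.

Definition is_red (x : color) : bool := if x is Red then true else false.
Lemma is_redK : cancel is_red (fun b => if b then Red else Green).
Proof. by case. Qed.
HB.instance Definition _ := Finite.copy color (can_type is_redK).

(* Exactly two red edges, cyclically consecutive, means that the colors read
   Red, Red, Green, Green from a suitable starting edge. *)
Definition lucas_at (n : nat) (c : {ffun gedge n -> color})
    (i j : 'I_n) : bool :=
  let s := [seq c e | e <- edges_around i j] in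
  [|| all (pred1 Green) s, all (pred1 Red) s
    | [exists r : 'I_4, rot r s == [:: Red; Red; Green; Green]]].

Definition side_alternating (n : nat) (c : {ffun gedge n -> color})
    (s : side) : bool :=
  [forall k : 'I_n, forall l : 'I_n,
    (l == k.+1 :> nat) ==> (c (boundary_edge s k) != c (boundary_edge s l))].

(* a and z are the first and last indices. *)
Definition corners_agree (n : nat) (c : {ffun gedge n -> color}) : bool :=
  [forall a : 'I_n, forall z : 'I_n, (a == 0%N :> nat) && (z.+1 == n) ==>
    [&& c (boundary_edge Left a) == c (boundary_edge Top a),
        c (boundary_edge Top z) == c (boundary_edge Right a),
        c (boundary_edge Right z) == c (boundary_edge Bottom z)
      & c (boundary_edge Bottom a) == c (boundary_edge Left z)]].

Definition top_left_green (n : nat) (c : {ffun gedge n -> color}) : bool :=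
  [forall a : 'I_n, (a == 0%N :> nat) ==> (c (boundary_edge Left a) == Green)].

Definition is_reslucas (n : nat) (c : {ffun gedge n -> color}) : bool :=
  [&& [forall i, forall j, lucas_at c i j],
      all (side_alternating c) [:: Left; Top; Right; Bottom],
      corners_agree c
    & top_left_green c].

Definition ResLuc (n : nat) : Type :=
  {c : {ffun gedge n -> color} | is_reslucas c}.

(* Main.v *)
Require Import Defs.
From mathcomp Require Import all_boot all_order all_algebra.

Set Implicit Arguments.
Unset Strict Implicit.
Unset Printing Implicit Defensive.

Import GRing.Theory.
Local Open Scope ring_scope.

(** An alternating sign matrix is determined by the partial sums of its rows and
    columns.  These lie in {0, 1}, start at 0 and end at 1, and the increments
    of the row and column sums agree at every entry: this is the six-vertex
    model with domain wall boundary.  Label the edges of the grid by the partial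
    sums and flip the label of the [k]-th edge of the [i]-th line whenever
    [i + k] is odd.  At each internal vertex this exchanges the six-vertex
    rule with the Lucas rule, and it turns the constant labels of each side into
    alternating ones that agree at the corners. *)

Lemma sig_bijective (T U : Type) (P : pred T) (Q : pred U)
    (f : T -> U) (g : U -> T) :
  (forall x, P x -> Q (f x)) -> (forall y, Q y -> P (g y)) ->
  (forall x, P x -> g (f x) = x) -> (forall y, Q y -> f (g y) = y) ->
  exists h : {x | P x} -> {y | Q y}, bijective h.
Proof.
move=> PQ QP fK gK.
exists (fun x => exist _ (f (sval x)) (PQ _ (svalP x))).
by exists (fun y => exist _ (g (sval y)) (QP _ (svalP y))) => [[x Px]|[y Qy]];
  apply: val_inj; rewrite /= ?fK ?gK.
Qed.

Lemma exists_ord_has n (P : pred nat) :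
  [exists r : 'I_n, P r] = has P (iota 0 n).
Proof.
apply/existsP/hasP => [[r Pr]|[r]].
  by exists (val r); rewrite ?mem_iota /=.
by rewrite mem_iota => r_lt Pr; exists (Ordinal r_lt).
Qed.

Lemma eq_color (x y : color) : (x == y) = (is_red x == is_red y).
Proof. by case: x; case: y. Qed.

(** * Sequences of signs with partial sums in {0, 1} *)

Definition is_bit (x : int) : bool := x \in [:: 0; 1].
Definition is_sign (x : int) : bool := x \in [:: -1; 0; 1].

Lemma is_bitP (x : int) : reflect (exists b : bool, x = b%:Z) (is_bit x).
Proof.
apply: (iffP idP) => [|[[] ->] //]; rewrite /is_bit !inE.
by case/orP=> /eqP->; [exists false | exists true].
Qed.

Lemma is_bit_eq1 (x : int) : is_bit x -> (x == 1)%:Z = x.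
Proof. by case/is_bitP=> [[]] ->. Qed.

Lemma is_signP (x : int) : is_sign x -> [\/ x = -1, x = 0 | x = 1].
Proof. by rewrite /is_sign !inE => /or3P[] /eqP->; constructor. Qed.

Lemma is_sign_bit_diff (x y : int) : is_bit x -> is_bit (x + y) -> is_sign y.
Proof.
case/is_bitP=> b ->; case/is_bitP=> b' /(canRL (addKr _))->.
by case: b; case: b'.
Qed.

Lemma all_sign_scanl (b : int) (s : seq int) :
  all is_bit (b :: scanl +%R b s) -> all is_sign s.
Proof.
elim: s b => //= x s IHs b /and3P[bit_b bit_bx bits].
by rewrite (is_sign_bit_diff bit_b bit_bx) (IHs (b + x)) //= bit_bx.
Qed.

Lemma is_bit_scanl_total (b : int) (s : seq int) :
  all is_bit (b :: scanl +%R b s) -> is_bit (b + \sum_(x <- s) x).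
Proof.
elim: s b => [|x s IHs] b /=; first by rewrite big_nil addr0 andbT.
by case/andP=> _ bits; rewrite big_cons addrA IHs.
Qed.

Definition alternating_from (x : int) (s : seq int) : bool :=
  path (fun y z => y * z < 0) x [seq y <- s | y != 0].

(* The partial sum is 1 exactly when the last nonzero entry was 1; the
   starting value stands for that entry. *)
Lemma alternating_from_scanl (b : bool) (s : seq int) : all is_sign s ->
  alternating_from (if b then 1 else -1) s
    = all is_bit (b%:Z :: scanl +%R b%:Z s).
Proof.
rewrite /alternating_from; elim: s b => [|x s IHs] b /=; first by case: b.
have -> /= : is_bit b%:Z by case: b.
case/andP=> /is_signP[] -> /IHs {}IHs.
- by case: b => //; apply: (IHs false).
- by rewrite /= addr0 IHs.
- by case: b => //; apply: (IHs true).
Qed.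

Lemma alternating_from_sum1 (s : seq int) :
    all is_sign s -> \sum_(x <- s) x = 1 -> sign_alternating s ->
  alternating_from (-1) s.
Proof.
rewrite /sign_alternating /alternating_from; elim: s => //= x s IHs /andP[].
case/is_signP=> -> //= signs; rewrite big_cons ?add0r; first last.
  exact: IHs.
(* A leading -1 leaves a tail of sum 2, whose partial sums are not all bits. *)
move=> total1; rewrite -/(alternating_from (-1) s).
rewrite (alternating_from_scanl false signs) => /is_bit_scanl_total.
by rewrite add0r -[X in is_bit X](addKr (-1)) total1.
Qed.

Lemma sign_alternating_scanl (s : seq int) : \sum_(x <- s) x = 1 ->
  all is_sign s && sign_alternating s = all is_bit (0 :: scanl +%R 0 s).
Proof.
move=> total1; apply/andP/idP => [[signs alternating]|bits].
  by rewrite -(alternating_from_scanl false signs) alternating_from_sum1.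
have signs := all_sign_scanl bits; split=> //.
by move: bits; rewrite -(alternating_from_scanl false signs) => /path_sorted.
Qed.

(** * Partial sums of a line *)

Definition psum (V : nmodType) n (F : 'I_n -> V) (k : nat) : V :=
  \sum_(j < n | (j < k)%N) F j.

Lemma psum0 (V : nmodType) n (F : 'I_n -> V) : psum F 0 = 0.
Proof. by rewrite /psum big_pred0. Qed.

Lemma psum_all (V : nmodType) n (F : 'I_n -> V) : psum F n = \sum_j F j.
Proof. by apply: eq_bigl => j; rewrite ltn_ord. Qed.

Lemma psum_recr (V : nmodType) n (F : 'I_n -> V) (j : 'I_n) :
  psum F j.+1 = psum F j + F j.
Proof.
rewrite /psum (bigD1 j) //= addrC; congr (_ + _).
by apply: eq_bigl => i; rewrite ltnS [RHS]ltn_neqAle andbC.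
Qed.

Lemma psum_recl (V : nmodType) n (F : 'I_n.+1 -> V) (k : nat) :
  psum F k.+1 = F ord0 + psum (F \o lift ord0) k.
Proof. by rewrite /psum big_mkcond big_ord_recl /= [in RHS]big_mkcond. Qed.

Lemma psum_telescope (V : zmodType) n (F : 'I_n -> V) (u : nat -> V) (k : nat) :
    (forall j, F j = u j.+1 - u j) -> (k <= n)%N -> psum F k = u k - u 0%N.
Proof.
move=> F_diff k_le_n; rewrite /psum (eq_bigr _ (fun j _ => F_diff j)).
rewrite -(big_ord_widen n (fun j => u j.+1 - u j)) //.
by rewrite -(big_mkord xpredT (fun j => u j.+1 - u j)) telescope_sumr.
Qed.

Lemma scanl_psum (V : nmodType) n (F : 'I_n -> V) (b : V) :
  b :: scanl +%R b [seq F j | j <- enum 'I_n]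
    = mkseq (fun k => b + psum F k) n.+1.
Proof.
elim: n F b => [|n IHn] F b.
  by rewrite (size0nil (size_enum_ord 0)) /mkseq /= psum0 addr0.
rewrite enum_ordSl /= -map_comp IHn [RHS]/mkseq.
rewrite -[iota 0 n.+2]/(0%N :: iota (1 + 0) n.+1) iotaDl map_cons -map_comp.
rewrite psum0 addr0; congr (_ :: _); apply: eq_map => k /=.
by rewrite psum_recl addrA.
Qed.

Definition asm_line n (F : 'I_n -> int) : Prop :=
  (forall k, (k <= n)%N -> is_bit (psum F k)) /\ \sum_j F j = 1.

Lemma asm_lineP n (F : 'I_n -> int) :
  asm_line F <->
  [/\ forall j, is_sign (F j), \sum_j F j = 1
    & sign_alternating [seq F j | j <- enum 'I_n]].
Proof.
set s := [seq F j | j <- enum 'I_n].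
have total : \sum_(x <- s) x = \sum_j F j by rewrite big_map big_enum.
have signsP : reflect (forall j, is_sign (F j)) (all is_sign s).
  rewrite all_map; apply: (iffP allP) => signs j.
    by apply: signs; rewrite mem_enum.
  by move=> _; apply: signs.
have bitsP : reflect (forall k, (k <= n)%N -> is_bit (psum F k))
                     (all is_bit (0 :: scanl +%R 0 s)).
  rewrite scanl_psum all_map.
  by apply: (iffP allP) => bits k; have := bits k; rewrite mem_iota /= add0r.
have bitsE := sign_alternating_scanl (s := s).
split=> [[/bitsP bits sum1]|[/signsP signs sum1 alternating]].
  by move: bits; rewrite -bitsE ?total // => /andP[/signsP].
by split=> //; apply/bitsP; rewrite -bitsE ?total // signs.
Qed.

Lemma asm_line_psum_diff n (F : 'I_n -> int) (j : 'I_n) : asm_line F ->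
  (psum F j.+1 == 1)%:Z - (psum F j == 1)%:Z = F j.
Proof.
case=> bits _; rewrite !is_bit_eq1 ?bits ?(ltnW (ltn_ord j)) //.
by rewrite psum_recr [X in X - _]addrC addrK.
Qed.

Section BitIncrements.

Variables (n : nat) (F : 'I_n -> int) (u : nat -> bool).
Hypothesis F_diff : forall j, F j = (u j.+1)%:Z - (u j)%:Z.
Hypothesis u_start : u 0%N = false.

Lemma psum_bit_increments (k : nat) : (k <= n)%N -> psum F k = (u k)%:Z.
Proof.
by move=> /(psum_telescope (u := fun k => (u k)%:Z) F_diff)->;
  rewrite u_start subr0.
Qed.

Lemma asm_line_bit_increments : u n = true -> asm_line F.
Proof.
move=> u_end; split=> [k /psum_bit_increments->|]; first by case: (u k).
by rewrite -psum_all psum_bit_increments ?u_end.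
Qed.

End BitIncrements.

(** * Lines of the grid *)

Variant direction := Horizontal | Vertical.

Definition matrix_line (T : Type) n (A : 'M[T]_n) (d : direction) (i j : 'I_n) :
    T :=
  if d is Horizontal then A i j else A j i.

Definition line_edge n (d : direction) (i : 'I_n) (k : nat) : gedge n :=
  if d is Horizontal then hedge i (inord k) else vedge i (inord k).

Lemma is_asmP n (A : 'M[int]_n) :
  is_asm A <-> forall d i, asm_line (matrix_line A d i).
Proof.
split=> [/and5P[/forallP signs /forallP row_sum /forallP col_sum]|lines].
  move=> /forallP row_alt /forallP col_alt.
  have sign i j : is_sign (A i j) by apply: (forallP (signs i) j).
  case=> i; apply/asm_lineP.
    by split=> [j||]; [apply: sign | apply/eqP/row_sum | apply: row_alt].
  by split=> [j||]; [apply: sign | apply/eqP/col_sum | apply: col_alt].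
have rowP i := (asm_lineP _).1 (lines Horizontal i).
have colP j := (asm_lineP _).1 (lines Vertical j).
apply/and5P; split; apply/forallP => i.
- by have [sign _ _] := rowP i; apply/forallP => j; apply: sign.
- by apply/eqP; have [] := rowP i.
- by apply/eqP; have [] := colP i.
- by have [] := rowP i.
- by have [] := colP i.
Qed.

Lemma eq_on_lines (T : Type) n (f g : {ffun gedge n -> T}) :
  (forall d i k, (k <= n)%N -> f (line_edge d i k) = g (line_edge d i k)) ->
  f = g.
Proof.
move=> fg; apply/ffunP => -[] [i k]; rewrite -(inord_val k).
  by apply: (fg Horizontal); rewrite -ltnS.
by apply: (fg Vertical); rewrite -ltnS.
Qed.

Definition labelling (T : Type) n (b : direction -> 'I_n -> nat -> T) :
    {ffun gedge n -> T} :=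
  [ffun e : gedge n =>
    match e with
    | inl (i, k) => b Horizontal i k
    | inr (j, k) => b Vertical j k
    end].

Lemma labelling_line_edge (T : Type) n (b : direction -> 'I_n -> nat -> T)
    d i k :
  (k <= n)%N -> labelling b (line_edge d i k) = b d i k.
Proof. by case: d => k_le_n; rewrite ffunE /= inordK. Qed.

Definition side_direction (s : side) : direction :=
  match s with Left | Right => Horizontal | Top | Bottom => Vertical end.

Definition far_side (s : side) : bool :=
  match s with Left | Top => false | Right | Bottom => true end.

Definition side_position n (s : side) : nat := if far_side s then n else 0%N.

Lemma boundary_edgeE n (s : side) (k : 'I_n) :
  boundary_edge s k = line_edge (side_direction s) k (side_position n s).
Proof.
by case: s; rewrite /line_edge /= ?(inord_val ord0) ?(inord_val ord_max).
Qed.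

(** * The six-vertex model with domain wall boundary *)

Section SixVertex.

Variables (n : nat) (l : {ffun gedge n -> bool}).

Definition label_increment (d : direction) (i j : 'I_n) : int :=
  (l (line_edge d i j.+1))%:Z - (l (line_edge d i j))%:Z.

Definition ice_rule_at (i j : 'I_n) : Prop :=
  label_increment Horizontal i j = label_increment Vertical j i.

Definition domain_wall : Prop :=
  forall d i, l (line_edge d i 0) = false /\ l (line_edge d i n) = true.

Definition is_six_vertex : Prop := (forall i j, ice_rule_at i j) /\ domain_wall.

Definition asm_of_six_vertex : 'M[int]_n :=
  \matrix_(i, j) label_increment Horizontal i j.

Lemma domain_wallP :
  domain_wall <-> forall s k, l (boundary_edge s k) = far_side s.
Proof.
split=> [wall s k|sides d i].
  by rewrite boundary_edgeE; have [] := wall (side_direction s) k; case: s.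
have line s :
    l (line_edge (side_direction s) i (side_position n s)) = far_side s.
  by rewrite -boundary_edgeE.
by case: d; split; [apply: (line Left) | apply: (line Right)
  | apply: (line Top) | apply: (line Bottom)].
Qed.

Hypothesis l_six_vertex : is_six_vertex.

Lemma matrix_line_asm_of_six_vertex d i j :
  matrix_line asm_of_six_vertex d i j = label_increment d i j.
Proof. by case: d; rewrite /= mxE // l_six_vertex.1. Qed.

Lemma is_asm_of_six_vertex : is_asm asm_of_six_vertex.
Proof.
apply/is_asmP => d i; have [start finish] := l_six_vertex.2 d i.
exact: (asm_line_bit_increments (u := fun k => l (line_edge d i k))
          (matrix_line_asm_of_six_vertex d i)).
Qed.

Lemma psum_asm_of_six_vertex d i k :
  (k <= n)%N ->
  psum (matrix_line asm_of_six_vertex d i) k = (l (line_edge d i k))%:Z.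
Proof.
have [start _] := l_six_vertex.2 d i.
exact: (psum_bit_increments (u := fun k => l (line_edge d i k))
          (matrix_line_asm_of_six_vertex d i)).
Qed.

End SixVertex.

Definition six_vertex_of_asm n (A : 'M[int]_n) : {ffun gedge n -> bool} :=
  labelling (fun d i k => psum (matrix_line A d i) k == 1).

Lemma label_increment_of_asm n (A : 'M[int]_n) d i j :
  is_asm A -> label_increment (six_vertex_of_asm A) d i j = matrix_line A d i j.
Proof.
move/is_asmP => lines; rewrite /label_increment.
by rewrite !labelling_line_edge ?(ltnW (ltn_ord j)) // asm_line_psum_diff.
Qed.

Lemma is_six_vertex_of_asm n (A : 'M[int]_n) :
  is_asm A -> is_six_vertex (six_vertex_of_asm A).
Proof.
move=> asmA; split=> [i j|d i].
  by rewrite /ice_rule_at !label_increment_of_asm.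
have [_ sum1] := (is_asmP A).1 asmA d i.
by rewrite !labelling_line_edge // psum0 psum_all sum1.
Qed.

Lemma six_vertex_of_asmK n (A : 'M[int]_n) :
  is_asm A -> asm_of_six_vertex (six_vertex_of_asm A) = A.
Proof.
by move=> asmA; apply/matrixP => i j; rewrite mxE label_increment_of_asm.
Qed.

Lemma asm_of_six_vertexK n (l : {ffun gedge n -> bool}) :
  is_six_vertex l -> six_vertex_of_asm (asm_of_six_vertex l) = l.
Proof.
move=> l_six_vertex; apply: eq_on_lines => d i k k_le_n.
by rewrite labelling_line_edge // psum_asm_of_six_vertex //; case: (l _).
Qed.

(** * Flipping labels along a checkerboard *)

Definition edge_parity n (e : gedge n) : bool :=
  match e with inl (i, k) | inr (i, k) => odd (i + k) end.

Definition six_vertex_of_coloring n (c : {ffun gedge n -> color}) :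
    {ffun gedge n -> bool} :=
  [ffun e => is_red (c e) (+) edge_parity e].

Definition coloring_of_six_vertex n (l : {ffun gedge n -> bool}) :
    {ffun gedge n -> color} :=
  [ffun e => if l e (+) edge_parity e then Red else Green].

Lemma six_vertex_of_coloringK n :
  cancel (@six_vertex_of_coloring n) (@coloring_of_six_vertex n).
Proof.
by move=> c; apply/ffunP => e; rewrite !ffunE -addbA addbb addbF is_redK.
Qed.

Lemma coloring_of_six_vertexK n :
  cancel (@coloring_of_six_vertex n) (@six_vertex_of_coloring n).
Proof.
by move=> l; apply/ffunP => e; rewrite !ffunE; case: (l e); case: edge_parity.
Qed.

Lemma edge_parity_line n d (i : 'I_n) k :
  (k <= n)%N -> edge_parity (line_edge d i k) = odd (i + k).
Proof. by case: d => k_le_n; rewrite /= inordK. Qed.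

Lemma lucas_atP n (c : {ffun gedge n -> color}) (i j : 'I_n) :
  lucas_at c i j <-> ice_rule_at (six_vertex_of_coloring c) i j.
Proof.
rewrite /lucas_at (exists_ord_has 4 (fun r => rot r _ == _)).
rewrite /ice_rule_at /label_increment.
rewrite !ffunE !edge_parity_line ?(ltnW (ltn_ord _)) // !addnS (addnC j i) /=.
by case: (c (hedge i (inord j))); case: (c (hedge i (inord j.+1)));
  case: (c (vedge j (inord i))); case: (c (vedge j (inord i.+1)));
  case: (odd (i + j)).
Qed.

Section Boundary.

Variables (n : nat) (c : {ffun gedge n.+1 -> color}).

Definition boundary_label (s : side) (k : 'I_n.+1) : bool :=
  six_vertex_of_coloring c (boundary_edge s k).

Lemma is_red_boundary s k :
  is_red (c (boundary_edge s k)) =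
    boundary_label s k (+) odd (k + side_position n.+1 s).
Proof.
rewrite /boundary_label ffunE boundary_edgeE edge_parity_line.
  by rewrite -addbA addbb addbF.
by case: s.
Qed.

Lemma side_alternatingP s :
  side_alternating c s <-> forall k, boundary_label s k = boundary_label s ord0.
Proof.
have flip (k l : 'I_n.+1) : l = k.+1 :> nat ->
    (c (boundary_edge s k) != c (boundary_edge s l)) =
    (boundary_label s l == boundary_label s k).
  move=> l_next; rewrite eq_color !is_red_boundary l_next !oddD /=.
  by do 2![case: boundary_label]; case: odd; case: odd.
split=> [/forallP alt [k k_lt]|constant].
  elim: k k_lt => [|k IHk] k_lt; first by congr boundary_label; apply: val_inj.
  rewrite -(IHk (ltnW k_lt)); apply/eqP; rewrite -flip //.
  have /forallP/(_ (Ordinal k_lt)) := alt (Ordinal (ltnW k_lt)).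
  by rewrite eqxx.
apply/forallP => k; apply/forallP => l; apply/implyP => /eqP l_next.
by rewrite flip // !constant.
Qed.

Lemma corners_agreeP :
  corners_agree c <->
  [/\ boundary_label Top ord0 = boundary_label Left ord0,
      boundary_label Right ord0 = ~~ boundary_label Top ord_max,
      boundary_label Bottom ord_max = boundary_label Right ord_max
    & boundary_label Left ord_max = ~~ boundary_label Bottom ord0].
Proof.
have -> : corners_agree c =
    [&& c (boundary_edge Left ord0) == c (boundary_edge Top ord0),
        c (boundary_edge Top ord_max) == c (boundary_edge Right ord0),
        c (boundary_edge Right ord_max) == c (boundary_edge Bottom ord_max)
      & c (boundary_edge Bottom ord0) == c (boundary_edge Left ord_max)].
  apply/forallP/idP => [/(_ ord0)/forallP/(_ ord_max)|corners a].
    by rewrite !eqxx.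
  apply/forallP => z; apply/implyP => /andP[/eqP a0 /eqP[z_max]].
  by have [-> ->] : a = ord0 /\ z = ord_max by split; apply: val_inj.
have eq_addb x y p q : (x (+) p == y (+) q) = (y == x (+) (p (+) q)).
  by case: x; case: y; case: p; case: q.
rewrite !eq_color !is_red_boundary !eq_addb /side_position /= !addn0 addnS /=.
rewrite !(addbN, addNb, addbb) !addbF negbK.
by split=> [/and4P[/eqP-> /eqP-> /eqP-> /eqP->]|[-> -> -> ->]]; rewrite ?eqxx.
Qed.

Lemma top_left_greenP : top_left_green c <-> boundary_label Left ord0 = false.
Proof.
have greenE :
    (c (boundary_edge Left ord0) == Green) = ~~ boundary_label Left ord0.
  by rewrite eq_color is_red_boundary addbF eqbF_neg.
rewrite /top_left_green; split=> [/forallP/(_ ord0)|label0].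
  by rewrite eqxx greenE => /negbTE.
apply/forallP => a; apply/implyP => /eqP a0.
by have -> : a = ord0 by [apply: val_inj]; rewrite greenE label0.
Qed.

Lemma domain_wall_boundaryP :
  [&& all (side_alternating c) [:: Left; Top; Right; Bottom],
      corners_agree c & top_left_green c] <->
  domain_wall (six_vertex_of_coloring c).
Proof.
apply: iff_trans (iff_sym (domain_wallP _)); split.
  case/and3P=> /and5P[/side_alternatingP left_const /side_alternatingP top_const
    /side_alternatingP right_const /side_alternatingP bottom_const _].
  case/corners_agreeP=> top_left top_right _ bottom_left.
  move/top_left_greenP=> left0.
  have top0 : boundary_label Top ord0 = false by rewrite top_left.
  case=> k; rewrite -/(boundary_label _ k).
  - by rewrite left_const.
  - by rewrite top_const.
  - by rewrite right_const top_right top_const top0.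
  - by rewrite bottom_const -[LHS]negbK -bottom_left left_const left0.
move=> wall; have labels s k : boundary_label s k = far_side s := wall s k.
apply/and3P; split.
- by apply/and5P; split=> //; apply/side_alternatingP => k; rewrite !labels.
- by apply/corners_agreeP; rewrite !labels.
- by apply/top_left_greenP; rewrite labels.
Qed.

Lemma is_reslucasP :
  is_reslucas c <-> is_six_vertex (six_vertex_of_coloring c).
Proof.
split=> [/andP[/forallP lucas /domain_wall_boundaryP wall]|[ice wall]].
  by split=> // i j; apply/lucas_atP/(forallP (lucas i)).
apply/andP; split; last exact/domain_wall_boundaryP.
by apply/forallP => i; apply/forallP => j; apply/lucas_atP.
Qed.

End Boundary.

Theorem theorem3 (n : nat) (hn : (1 <= n)%N) :
  exists f : ASM n -> ResLuc n, bijective f.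
Proof.
case: n hn => // n _.
apply: (@sig_bijective _ _ _ _
  (@coloring_of_six_vertex _ \o @six_vertex_of_asm _)
  (@asm_of_six_vertex _ \o @six_vertex_of_coloring _)) => /=.
- move=> A asmA; apply/is_reslucasP; rewrite coloring_of_six_vertexK.
  exact: is_six_vertex_of_asm.
- by move=> c /is_reslucasP; apply: is_asm_of_six_vertex.
- by move=> A asmA; rewrite coloring_of_six_vertexK six_vertex_of_asmK.
- move=> c /is_reslucasP six_vertex_c.
  by rewrite asm_of_six_vertexK // six_vertex_of_coloringK.
Qed.
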